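(* Let $n\ge 2$, let $G=\langle a_1,\dots,a_n\rangle$ be free of rank $n$, and let $V_n$ be the set of endomorphisms of $G$ whose Wagner tails are all different. If the limit defining the asymptotic density $D(V_n)$ exists, then $$D(V_n)\ \le\ \left(1-\frac1n+\frac{1}{2n(2n-1)}\right)^n.$$
   Context: Wagner tails: let $\phi:G\to G$ be an endomorphism. For each $i$ and each occurrence of a letter $a_i^{\epsilon}$ ($\epsilon=\pm1$) in the reduced word $\phi(a_i)$, write the reduced product $\phi(a_i)=v a_i^{\epsilon}\overline v$. This occurrence gives two Wagner tails: $w=v$ and $\overline w=\overline v^{-1}$ if $\epsilon=1$; $w=va_i^{-1}$ and $\overline w=\overline v^{-1}a_i$ if $\epsilon=-1$. In addition the wedge point (base point) has tails $w=\overline w=1$. The Wagner tails are ''all different'' if all these words (over all $i$ and all occurrences) are pairwise distinct elements of $G$ and different from $1$ (i.e. the only repetition is the repeated word $1$ at the wedge point). Density: let $G_p$ be the set of elements of $G$ of reduced word length at most $p$. An endomorphism $\phi$ is identified with $(\phi(a_1),\dots,\phi(a_n))\in G^n$. For a set $S\subset G^n$, $D(S)=\lim_{p\to\infty}\frac{|S\cap G_p^n|}{|G_p^n|}$, where $G_p^n=(G_p)^n$. *)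

(* Defs.v *)
From HB Require Import structures.
From mathcomp Require Import all_boot all_order all_algebra.
From mathcomp Require Import finmap.
From mathcomp Require Import all_classical all_reals all_analysis.

Set Implicit Arguments.
Unset Strict Implicit.
Unset Printing Implicit Defensive.

Import Order.TTheory GRing.Theory Num.Theory.
Import numFieldNormedType.Exports.

Local Open Scope classical_set_scope.

(* The letter (i, true) stands for a_i, and (i, false) for a_i^-1. *)
Notation letter n := ('I_n * bool)%type.

Definition linv n (x : letter n) : letter n := (x.1, ~~ x.2).

Definition reduced n (w : seq (letter n)) : bool :=
  sorted (fun x y => y != linv x) w.

(* The free group of rank n, realised on the reduced words. *)
Record freegroup n := FreeGroup {
  fgword :> seq (letter n);
  fgwordP : reduced fgword }.

HB.instance Definition _ n := [isSub for @fgword n].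
HB.instance Definition _ n := [Choice of freegroup n by <:].

Section FreeGroup.
Variable n : nat.
Implicit Types (x y : letter n) (w s t : seq (letter n)) (g h : freegroup n).

(* The reduced form of x :: w, for a reduced w. *)
Definition push x w :=
  if w is y :: w' then (if y == linv x then w' else x :: w) else [:: x].

Lemma linvK : involutive (@linv n).
Proof. by case=> i b; rewrite /linv /= negbK. Qed.

Lemma reduced_push x w : reduced w -> reduced (push x w).
Proof.
case: w => [//|y w] /= yw; case: eqP => [_|/eqP xy] /=; last by rewrite xy.
exact: path_sorted yw.
Qed.

Lemma pushK x w : reduced w -> push x (push (linv x) w) = w.
Proof.
case: w => [|y w] /= yw; first by rewrite eqxx.
rewrite linvK; case: (altP (y =P x)) => [yx|_] /=; last by rewrite eqxx.
subst y.
by case: w yw => [//|z w] /= /andP[/negPf -> _].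
Qed.

Lemma push_reduced x w : reduced (x :: w) -> push x w = x :: w.
Proof. by case: w => [//|y w] /= /andP[/negPf -> _]. Qed.

Lemma reduced_foldr s t : reduced t -> reduced (foldr push t s).
Proof. by move=> rt; elim: s => //= x s; apply: reduced_push. Qed.

(* The element of the free group represented by an arbitrary word. *)
Definition fgofword s : freegroup n :=
  FreeGroup (@reduced_foldr s [::] isT).

Lemma foldr_push_nil s : reduced s -> foldr push [::] s = s.
Proof.
elim: s => //= x s IHs xs; rewrite IHs ?push_reduced //.
exact: path_sorted xs.
Qed.

Lemma fgwordK g : fgofword g = g.
Proof. by apply: val_inj; rewrite /= foldr_push_nil // fgwordP. Qed.

Definition fgmul g h : freegroup n :=
  FreeGroup (@reduced_foldr g h (fgwordP h)).

Definition fgone : freegroup n := @FreeGroup n [::] isT.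

Definition winv w := rev (map (@linv n) w).

Lemma reduced_winv w : reduced w -> reduced (winv w).
Proof.
rewrite /reduced /winv rev_sorted sorted_map; apply: sub_sorted => x y /=.
by rewrite linvK; apply: contra => /eqP ->.
Qed.

Definition fginv g : freegroup n := FreeGroup (reduced_winv (fgwordP g)).

Lemma foldr_push_push x w s : reduced s ->
  foldr push s (push x w) = push x (foldr push s w).
Proof.
case: w => [//|y w] /= rs; case: eqP => [-> /=|//].
by rewrite pushK // reduced_foldr.
Qed.

Lemma fgmulA : associative fgmul.
Proof.
move=> g h k; apply: val_inj => /=; elim: (fgword g) => //= x w ->.
by rewrite foldr_push_push // fgwordP.
Qed.

Lemma fgmul1g : left_id fgone fgmul.
Proof. by move=> g; apply: val_inj. Qed.

Lemma fgmulg1 : right_id fgone fgmul.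
Proof. by move=> g; apply: val_inj; rewrite /= foldr_push_nil // fgwordP. Qed.

Lemma winvP w s : reduced s -> foldr push (foldr push s w) (winv w) = s.
Proof.
move=> rs; elim: w => //= x w IHw.
rewrite /winv /= rev_cons -cats1 foldr_cat /=.
rewrite -{2}(linvK x) pushK ?IHw //; exact: reduced_foldr.
Qed.

Lemma fgmulVg : left_inverse fgone fginv fgmul.
Proof.
move=> g; apply: val_inj => /=.
by rewrite -{1}(foldr_push_nil (fgwordP g)) winvP.
Qed.

Lemma winvK : involutive winv.
Proof.
by move=> w; rewrite /winv map_rev revK mapK //; apply: linvK.
Qed.

Lemma fgmulgV : right_inverse fgone fginv fgmul.
Proof.
move=> g; rewrite -{1}(_ : fginv (fginv g) = g) ?fgmulVg //.
by apply: val_inj; rewrite /= winvK.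
Qed.

HB.instance Definition _ := isGroup.Build (freegroup n)
  fgmulA fgmul1g fgmulg1 fgmulVg fgmulgV.

Definition fggen (i : 'I_n) : freegroup n := @FreeGroup n [:: (i, true)] isT.

End FreeGroup.

Section UniversalProperty.
Variables (n : nat) (H : groupType) (f : 'I_n -> H).
Local Open Scope group_scope.

Definition fgeval (w : seq (letter n)) : H :=
  foldr (fun x h => (if x.2 then f x.1 else (f x.1)^-1) * h) 1 w.

Definition fglift (g : freegroup n) : H := fgeval g.

Lemma fgeval_push x w : fgeval (push x w) = fgeval (x :: w).
Proof.
case: w => [//|y w] /=; case: eqP => [-> /=|//].
by case: x => i [] /=; rewrite mulgA ?mulgV ?mulVg mul1g.
Qed.

Lemma fglift_is_multiplicative : {morph fglift : g h / g * h}.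
Proof.
move=> g h; rewrite /fglift /=; elim: (fgword g) => [|x w IHw] /=.
  by rewrite mul1g.
by rewrite fgeval_push /= IHw mulgA.
Qed.

HB.instance Definition _ :=
  isMultiplicative.Build (freegroup n) H fglift fglift_is_multiplicative.

Lemma fglift_gen i : fglift (fggen i) = f i.
Proof. by rewrite /fglift /= mulg1. Qed.

Lemma fglift_unique (phi : {multiplicative freegroup n -> H}) :
  (forall i, phi (fggen i) = f i) -> phi =1 fglift.
Proof.
move=> phif.
have phi1 : phi 1 = 1 by apply: (mulgI (phi 1)); rewrite -gmulfM !mulg1.
have phiV g : phi g^-1 = (phi g)^-1.
  by apply: (mulgI (phi g)); rewrite -gmulfM !mulgV phi1.
suff E w : phi (fgofword w) = fgeval w by move=> g; rewrite -{1}(fgwordK g) E.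
elim: w => [|[i b] w IHw] /=.
  by rewrite -phi1; congr (phi _); apply: val_inj.
rewrite -IHw -phif.
case: b; rewrite -?phiV -gmulfM; congr (phi _); exact: val_inj.
Qed.

End UniversalProperty.

Section WagnerTails.
Variable n : nat.
Local Open Scope group_scope.

(* If the letter of w at position k (counting from 0) is a_i or a_i^-1, the
   two tails which that occurrence of a_i^{+-1} gives; otherwise no tail. *)
Definition occ_tails (i : 'I_n) (w : seq (letter n)) (k : nat) :
    seq (freegroup n) :=
  let v := fgofword (take k w) in
  if drop k w is (j, eps) :: s then
    let vbar := fgofword s in
    if j != i then [::]
    else if eps then [:: v; vbar^-1]
    else [:: v * (fggen i)^-1; vbar^-1 * fggen i]
  else [::].

(* The tails at the occurrences of the a_i^{+-1} in phi (a_i), listed with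
   multiplicity; the tail 1 of the wedge point is not in the list. *)
Definition wagner_tails (phi : {multiplicative freegroup n -> freegroup n}) :
    seq (freegroup n) :=
  flatten [seq occ_tails i (phi (fggen i)) k
          | i <- enum 'I_n, k <- iota 0 (size (phi (fggen i)))].

Definition tails_all_different
    (phi : {multiplicative freegroup n -> freegroup n}) : bool :=
  uniq (1 :: wagner_tails phi).

Definition wagner_endo : set {multiplicative freegroup n -> freegroup n} :=
  [set phi | tails_all_different phi].

(* By fglift_gen and fglift_unique this identifies End(G) with G^n. *)
Definition endo_tuple (phi : {multiplicative freegroup n -> freegroup n}) :
    {ffun 'I_n -> freegroup n} :=
  [ffun i => phi (fggen i)].

End WagnerTails.

Section Density.
Variable n : nat.

Definition fgball (p : nat) : set (freegroup n) :=
  [set g | (size (fgword g) <= p)%N].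

Definition fgball_pow (p : nat) : set {ffun 'I_n -> freegroup n} :=
  [set f | forall i, fgball p (f i)].

(* fset_set is the empty set on infinite sets; the next two lemmas show that
   this case does not arise in density_seq. *)
Lemma finite_fgball p : finite_set (fgball p).
Proof.
pose T := {k : 'I_p.+1 & k.-tuple (letter n)}.
pose F (t : T) : freegroup n := fgofword (tagged t).
apply: (@sub_finite_set _ _ (F @` setT)); last exact/finite_image/finite_finset.
move=> g gp; have gp1 : (size (fgword g) < p.+1)%N by [].
exists (Tagged (fun k : 'I_p.+1 => k.-tuple (letter n))
          (in_tuple (fgword g) : (Ordinal gp1).-tuple _)) => //.
exact: fgwordK.
Qed.

Lemma finite_fgball_pow p : finite_set (fgball_pow p).
Proof.
pose B := fset_set (fgball p).
pose F (t : {ffun 'I_n -> B}) : {ffun 'I_n -> freegroup n} :=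
  [ffun i => val (t i)].
apply: (@sub_finite_set _ _ (F @` setT)); last exact/finite_image/finite_finset.
move=> f fp.
have fB i : f i \in B by rewrite in_fset_set ?inE //; exact: finite_fgball.
exists [ffun i => [` fB i]%fset] => //.
by apply/ffunP => i; rewrite !ffunE.
Qed.

Local Open Scope ring_scope.

Definition density_seq (R : realType) (S : set {ffun 'I_n -> freegroup n})
    (p : nat) : R :=
  #|` fset_set (S `&` fgball_pow p)|%:R / #|` fset_set (fgball_pow p)|%:R.

Definition density_exists (R : realType) S : Prop := cvgn (@density_seq R S).

Definition density (R : realType) S : R := limn (@density_seq R S).

End Density.

(* Main.v *)
Require Import Defs.
From mathcomp Require Import all_boot all_order all_algebra.
From mathcomp Require Import finmap zify ring lra.
From mathcomp Require Import all_classical all_reals all_analysis.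

Set Implicit Arguments.
Unset Strict Implicit.
Unset Printing Implicit Defensive.

Import Order.TTheory GRing.Theory Num.Theory.
Import numFieldNormedType.Exports.

(** The wedge point contributes the tail 1, so an endomorphism whose Wagner
    tails are all different can produce the tail 1 nowhere else.  But if the
    reduced word phi(a_i) begins with a_i, then the tail v of this first
    occurrence is the empty word, and if it ends with a_i, then the tail vbar^-1
    of this last occurrence is 1.  Hence each phi(a_i) neither begins nor ends
    with a_i ([wagner_avoids_ends]), and these n conditions constrain the n
    coordinates of phi separately.

    It remains to find the proportion of reduced words avoiding a letter a at
    both ends.  Put d = 2n - 1.  Reduced words are the walks in the
    d-regular relation `y is not the inverse of x', so there are
    2n d^(k-1) of them of length k >= 1.  A walk from x of given length is
    counted by a power of d, and so are the walks of given length to y, since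
    the relation is also d-regular backwards.  Of the 2n d^(k-1) words,
    d^(k-1) begin with a and d^(k-1) end with a, and for k >= 2 at most d^(k-2)
    do both, because the last letter is imposed.  By inclusion and exclusion the
    proportion avoiding a at both ends is at most

      1 - 2 / (2n) + 1 / (2n d)  =  1 - 1/n + 1 / (2n (2n - 1)).

    For the lengths 0 and 1 this fails by a bounded amount only
    ([nwords_avoiding_le]).  Summing over the lengths up to p, the proportion in
    the ball G_p is at most the above constant plus 2 / |G_p|, and |G_p| > p.
    Taking the product over the n coordinates ([density_seq_wagner_le]) and
    letting p go to infinity gives the bound. *)

(** * Walks in a regular relation *)

Section Walks.
Variables (T : finType) (e : rel T) (d : nat).
Local Open Scope nat_scope.

Lemma card_tuples_cons k (P : pred (seq T)) :
  #|[pred t : k.+1.-tuple T | P t]|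
    = \sum_(x : T) #|[pred t : k.-tuple T | P (x :: t)]|.
Proof.
under eq_bigr do rewrite -sum1_card.
rewrite -sum1_card pair_big_dep /=.
rewrite (reindex (fun p : T * k.-tuple T => [tuple of p.1 :: p.2])) //=.
exists (fun t : k.+1.-tuple T => (thead t, [tuple of behead t])).
  by move=> [x t] _; congr (_, _); apply: val_inj.
by move=> t _; rewrite /= -tuple_eta.
Qed.

Definition walks k x (A : pred T) : nat :=
  #|[pred t : k.-tuple T | path e x t && A (last x t)]|.

Lemma walks0 x A : walks 0 x A = A x.
Proof.
rewrite /walks; case: (boolP (A x)) => Ax /=.
  transitivity #|{: 0.-tuple T}|; last by rewrite card_tuple.
  by apply: eq_card => t; rewrite !inE (tuple0 t) /= Ax.
by apply: eq_card0 => t; rewrite !inE (tuple0 t) /= (negPf Ax).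
Qed.

Lemma walksS k x A : walks k.+1 x A = \sum_(y | e x y) walks k y A.
Proof.
rewrite /walks (card_tuples_cons _ (fun s => path e x s && A (last x s))).
rewrite [RHS]big_mkcond /=; apply: eq_bigr => y _.
case: ifP => exy //; exact: eq_card0.
Qed.

(** Out-regularity gives d choices for every step. *)
Lemma walks_all k x : (forall y, #|e y| = d) ->
  walks k x predT = d ^ k.
Proof.
move=> out_reg; elim: k x => [|k IHk] x; first by rewrite walks0.
rewrite walksS; under eq_bigr do rewrite IHk.
by rewrite sum_nat_cond_const cardsE out_reg expnS.
Qed.

Lemma sum_walks0_to a : \sum_x walks 0 x (pred1 a) = 1.
Proof.
under eq_bigr do rewrite walks0 /=.
by rewrite (bigD1 a) //= eqxx big1 ?addn0 // => x /negPf ->.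
Qed.

(** Counted backwards from the endpoint: in-regularity gives d choices for every
    predecessor. *)
Lemma sum_walks_to k a : (forall y, #|e^~ y| = d) ->
  \sum_x walks k x (pred1 a) = d ^ k.
Proof.
move=> in_reg; elim: k => [|k IHk]; first exact: sum_walks0_to.
under eq_bigr do rewrite walksS.
rewrite (exchange_big_dep predT) //=.
under eq_bigr do rewrite sum_nat_cond_const cardsE in_reg.
by rewrite -big_distrr /= IHk expnS.
Qed.

(** The first k steps are free; the last one has to reach a. *)
Lemma walks_to_le k x a : (forall y, #|e y| = d) ->
  walks k.+1 x (pred1 a) <= d ^ k.
Proof.
move=> out_reg; elim: k x => [|k IHk] x; rewrite walksS.
  rewrite expn0 -[leqRHS](sum_walks0_to a) big_mkcond.
  by apply: leq_sum => y _; case: ifP.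
rewrite expnS -{1}(out_reg x) -cardsE -sum_nat_cond_const.
by apply: leq_sum => y _; apply: IHk.
Qed.

(** Inclusion and exclusion for the walks of length k that neither start nor end
    at a: from the walks that do not start at a, remove those that end at a,
    which are all the d ^ k walks ending at a except those that also start
    there. *)
Lemma sum_walks_avoiding k a :
  (forall y, #|e y| = d) -> (forall y, #|e^~ y| = d) ->
  \sum_(x | x != a) walks k x (predC1 a) + d ^ k
    = #|T|.-1 * d ^ k + walks k a (pred1 a).
Proof.
move=> out_reg in_reg.
have := sum_walks_to k a in_reg; rewrite (bigD1 a) //= => to_a.
rewrite -{1}to_a addnCA [RHS]addnC.
congr (_ + _); rewrite -big_split /= -(cardC1 a) -sum_nat_const.
apply: eq_big => [x|x _]; first by rewrite !inE.
rewrite -(walks_all k x out_reg) /walks.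
rewrite -[RHS](cardID [pred t : k.-tuple T | last x t == a]) addnC.
by congr (_ + _); apply: eq_card => t; rewrite !inE /= ?andbT // andbC.
Qed.

End Walks.

(** * Counting reduced words *)

Section ReducedWords.
Variable n : nat.
Local Open Scope nat_scope.

Definition nocancel : rel (letter n) := fun x y => y != linv x.

Lemma card_letter : #|{: letter n}| = n * 2.
Proof. by rewrite card_prod card_ord card_bool. Qed.

Lemma card_nocancel x : #|nocancel x| = (n * 2).-1.
Proof. by rewrite -card_letter -(cardC1 (linv x)); apply: eq_card. Qed.

Lemma card_nocancel_rev y : #|nocancel^~ y| = (n * 2).-1.
Proof.
rewrite -card_letter -(cardC1 (linv y)); apply: eq_card => x.
by rewrite !inE /nocancel -(inj_eq (can_inj (@linvK n))) linvK eq_sym.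
Qed.

Definition avoids_ends a (w : seq (letter n)) : bool :=
  if w is x :: s then (x != a) && (last x s != a) else true.

Definition nwords k (P : pred (seq (letter n))) : nat :=
  #|[pred t : k.-tuple (letter n) | reduced t && P t]|.

Lemma nwords0 (P : pred (seq (letter n))) : P [::] -> nwords 0 P = 1.
Proof.
move=> P0; transitivity #|{: 0.-tuple (letter n)}|; last by rewrite card_tuple.
by apply: eq_card => t; rewrite !inE (tuple0 t) /= P0.
Qed.

Lemma nwordsS k : nwords k.+1 predT = n * 2 * (n * 2).-1 ^ k.
Proof.
rewrite /nwords (card_tuples_cons _ (fun w => reduced w && true)).
rewrite -card_letter -sum_nat_const card_letter; apply: eq_bigr => x _.
exact: (walks_all _ _ card_nocancel).
Qed.

(** The last term counts the words of length [k.+1] with a at both ends. *)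
Lemma nwords_avoiding k a :
  nwords k.+1 (avoids_ends a) + (n * 2).-1 ^ k
    = (n * 2).-1 ^ k.+1 + walks nocancel k a (pred1 a).
Proof.
rewrite expnS -{2}card_letter.
rewrite -(sum_walks_avoiding k a card_nocancel card_nocancel_rev).
congr (_ + _).
rewrite /nwords (card_tuples_cons _ (fun w => reduced w && avoids_ends a w)).
rewrite [RHS]big_mkcond; apply: eq_bigr => x _ /=.
by case: ifP => xa //; apply: eq_card0 => t; rewrite !inE andbF.
Qed.

(** The bound 1 - 1/n + 1/(2n(2n-1)) on the proportion of words avoiding a,
    multiplied by the number of words of length k and by its denominator.  The
    extra term is needed in length 0, where the single word avoids a, and in
    length 1, where the two ends are the same letter. *)
Lemma nwords_avoiding_le k a : 0 < n ->
  n * 2 * (n * 2).-1 * nwords k (avoids_ends a)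
      + 2 * (n * 2).-1 * nwords k predT
    <= (n * 2 * (n * 2).-1).+1 * nwords k predT
      + n * 2 * (n * 2).-1 * (k < 2).
Proof.
move=> n_gt0; move: (nwordsS) (nwords_avoiding ^~ a).
move: (fun k => walks_to_le k a a card_nocancel).
have -> : n * 2 = (n * 2).-1.+1 by rewrite prednK // muln_gt0 n_gt0.
move: (n * 2).-1 => d /= walks_le allE avoidE.
case: k => [|k]; first by rewrite !nwords0 //=; nia.
have := avoidE k; rewrite allE.
case: k => [|k] /=.
  rewrite walks0 /= eqxx expn1 expn0 => /addIn ->; nia.
have := walks_le k; rewrite !expnS.
set good := nwords _ _; set m := d ^ k; set w := walks _ _ _ _ => w_le goodE.
(* The number of words of this length is d (d + 1) m, and dropping those that
   begin or end with a leaves at most (d (d + 1) - 2 d + 1) m. *)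
have : good <= (d * d - d + 1) * m by nia.
nia.
Qed.

End ReducedWords.

(** * Cardinalities of balls and of their products *)

Section BallCounts.
Local Open Scope classical_set_scope.

Lemma card_fset_set_ffun (I : finType) (V : choiceType) (A : I -> set V) :
  (forall i, finite_set (A i)) ->
  #|` fset_set [set f : {ffun I -> V} | forall i, A i (f i)]|
    = (\prod_i #|` fset_set (A i)|)%N.
Proof.
move=> finA.
pose F (t : {dffun forall i, fset_set (A i)}) : {ffun I -> V} :=
  [ffun i => val (t i)].
have F_inj : injective F.
  move=> t u /ffunP tu; apply/ffunP => i; apply: val_inj.
  by have := tu i; rewrite !ffunE.
have -> : [set f : {ffun I -> V} | forall i, A i (f i)] = range F.
  apply/seteqP; split => [f Af|_ [t _ <-] i] /=; last first.
    by rewrite ffunE; have := valP (t i); rewrite in_fset_set // inE.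
  have fA i : f i \in fset_set (A i) by rewrite in_fset_set // inE.
  by exists [ffun i => [` fA i]%fset] => //; apply/ffunP => i; rewrite !ffunE.
have -> : fset_set (range F) = [fset F t | t in predT]%fset.
  apply/fsetP => f; rewrite in_fset_set; last exact/finite_image/finite_finset.
  apply/idP/imfsetP => [/set_mem[t _ <-]|[t _ ->]]; first by exists t.
  by apply/mem_set; exists t.
rewrite card_imfset //= -cardE card_dep_ffun.
rewrite foldrE big_map big_enum; apply: eq_bigr => i _.
by rewrite cardfE.
Qed.

Variable n : nat.

Definition fgball_in (P : pred (seq (letter n))) p : set (freegroup n) :=
  fgball p `&` [set g | P (fgword g)].

Lemma finite_fgball_in P p : finite_set (fgball_in P p).
Proof. exact/finite_setIl/finite_fgball. Qed.

Lemma card_fgball_in P p :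
  #|` fset_set (fgball_in P p)| = (\sum_(k < p.+1) nwords k P)%N.
Proof.
pose U := {k : 'I_p.+1 & k.-tuple (letter n)}.
pose D := [pred u : U | reduced (tagged u) && P (tagged u)].
pose F (u : U) : freegroup n := fgofword (tagged u).
have FK u : u \in D -> fgword (F u) = tagged u.
  by rewrite inE => /andP[ru _]; rewrite /= foldr_push_nil.
have F_inj : {in D &, injective F}.
  move=> u v Du Dv /(congr1 (@fgword n)); rewrite !FK //.
  case: u {Du} => k t; case: v {Dv} => l u /= tu.
  have kl : k = l by
    apply: val_inj; rewrite -[LHS](size_tuple t) -[RHS](size_tuple u) tu.
  by subst l; congr Tagged; apply: val_inj.
have -> : fset_set (fgball_in P p) = [fset F u | u in D]%fset.
  apply/fsetP => g; rewrite in_fset_set; last exact: finite_fgball_in.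
  apply/idP/imfsetP => [/set_mem[gp Pg]|[u Du ->]].
    have gp1 : (size (fgword g) < p.+1)%N by [].
    exists (Tagged (fun k : 'I_p.+1 => k.-tuple (letter n))
              (in_tuple (fgword g) : (Ordinal gp1).-tuple _)).
      by rewrite !inE /= fgwordP.
    by rewrite /F /= fgwordK.
  apply/mem_set; split; rewrite /fgball /mkset (FK _ Du).
    by rewrite size_tuple -ltnS.
  by move: Du; rewrite inE => /andP[].
rewrite card_in_imfset //= -cardE -sum1_card.
under [RHS]eq_bigr do rewrite /nwords -sum1_card.
by rewrite sig_big_dep.
Qed.

End BallCounts.

(** * The density of the endomorphisms with different Wagner tails *)

Section WagnerDensity.
Variable n : nat.
Local Open Scope classical_set_scope.

Lemma card_fgball p :
  #|` fset_set (@fgball n p)| = (\sum_(k < p.+1) @nwords n k predT)%N.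
Proof.
rewrite -card_fgball_in; congr (#|` fset_set _|).
by apply/seteqP; split => g // [].
Qed.

Lemma card_fgball_ge p : (0 < n)%N -> (p.+1 <= #|` fset_set (@fgball n p)|)%N.
Proof.
move=> n_gt0; rewrite card_fgball -{1}(card_ord p.+1) -sum1_card.
apply: leq_sum => -[[|k] _] _ /=; first by rewrite nwords0.
by rewrite nwordsS muln_gt0 expn_gt0 muln_gt0 n_gt0 /=; lia.
Qed.

(** [nwords_avoiding_le] summed over the lengths up to p; its extra term occurs
    for two lengths at most. *)
Lemma card_fgball_avoiding_le p (a : letter n) : (0 < n)%N ->
  (n * 2 * (n * 2).-1 * #|` fset_set (fgball_in (avoids_ends a) p)|
      + 2 * (n * 2).-1 * #|` fset_set (@fgball n p)|
    <= (n * 2 * (n * 2).-1).+1 * #|` fset_set (@fgball n p)|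
        + 2 * (n * 2 * (n * 2).-1))%N.
Proof.
move=> n_gt0; rewrite card_fgball card_fgball_in; set C := (n * 2 * _)%N.
have short : (\sum_(k < p.+1) (k < 2) <= 2)%N.
  case: p => [|p]; first by rewrite big_ord_recl big_ord0.
  by rewrite !big_ord_recl big1.
have : (\sum_(k < p.+1) (C * nwords k (avoids_ends a)
                         + 2 * (n * 2).-1 * @nwords n k predT)
    <= \sum_(k < p.+1) (C.+1 * @nwords n k predT + C * (k < 2)))%N.
  by apply: leq_sum => k _; apply: nwords_avoiding_le.
rewrite !big_split -!big_distrr /= => /leq_trans; apply.
by rewrite leq_add2l [leqRHS]mulnC leq_mul2l short orbT.
Qed.

(** An occurrence of a_i at the beginning of phi(a_i) has the tail v = 1, and
    one at the end has the tail vbar^-1 = 1: either repeats the tail of the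
    wedge point.  An occurrence of a_i^-1 never has the tail 1, because phi(a_i)
    is reduced; so only the letter [(i, true)] is excluded. *)
Lemma wagner_avoids_ends phi i : tails_all_different phi ->
  avoids_ends (i, true) (fgword (phi (@fggen n i))).
Proof.
rewrite /tails_all_different cons_uniq => /andP[].
move=> /negP tails1 _; set w := fgword _.
have tail1 k : (k < size w)%N -> 1%g \in occ_tails i w k -> False.
  move=> kw kt; apply: tails1; apply/flattenP; exists (occ_tails i w k) => //.
  apply/allpairsPdep; exists i, k; split => //; first by rewrite mem_enum.
  by rewrite mem_iota.
case: {-1}w (erefl w) => [//|x s] wE /=; apply/andP; split; apply/eqP.
  move=> xa; apply: (tail1 0%N); first by rewrite wE.
  rewrite /occ_tails wE xa take0 drop0 eqxx /= inE.
  by apply/orP; left; apply/eqP/val_inj.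
move=> sa; apply: (tail1 (size s)); first by rewrite wE.
rewrite /occ_tails wE lastI sa -(size_belast x s) -cats1 drop_size_cat // eqxx.
have -> : fgofword [::] = 1%g :> freegroup n by apply: val_inj.
by rewrite invg1 !inE eqxx orbT.
Qed.

Lemma card_wagner_le p :
  (#|` fset_set (@endo_tuple n @` @wagner_endo n `&` @fgball_pow n p)|
    <= \prod_(i < n) #|` fset_set (fgball_in (avoids_ends (i, true)) p)|)%N.
Proof.
rewrite -card_fset_set_ffun => [|i]; last exact: finite_fgball_in.
apply: fsubset_leq_card; rewrite -fset_set_sub.
- move=> _ [[phi Wphi <-] phip] i; split; first exact: phip.
  by rewrite /= ffunE; apply: wagner_avoids_ends.
- exact/finite_setIr/finite_fgball_pow.
- by apply: (sub_finite_set _ (finite_fgball_pow n p)) => f fP i; case: (fP i).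
Qed.

Local Open Scope ring_scope.

(** The coordinates are constrained separately, so the proportions multiply.
    The error term 2 / |G_p| of each is replaced by the larger 2 / (p + 1),
    which visibly tends to 0. *)
Lemma density_seq_wagner_le (R : realType) p : (0 < n)%N ->
  density_seq R (@endo_tuple n @` @wagner_endo n) p
    <= (1 - n%:R^-1 + (2 * n%:R * (2 * n%:R - 1))^-1 + 2 * harmonic p) ^+ n.
Proof.
move=> n_gt0; rewrite /density_seq.
have -> : #|` fset_set (@fgball_pow n p)|
    = (\prod_(i < n) #|` fset_set (@fgball n p)|)%N.
  by rewrite -card_fset_set_ffun // => i; apply: finite_fgball.
have ball_ge := card_fgball_ge p n_gt0.
set b := #|` fset_set (@fgball n p)| in ball_ge *.
apply: (@le_trans _ _ (\prod_(i < n)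
    (#|` fset_set (fgball_in (avoids_ends (i, true)) p)|%:R / b%:R))).
  rewrite big_split /= prodfV -!natr_prod ler_wpM2r ?invr_ge0 //.
  by rewrite ler_nat card_wagner_le.
rewrite -[X in _ <= _ ^+ X](card_ord n) -prodr_const; apply: ler_prod => i _.
rewrite divr_ge0 //=.
have := card_fgball_avoiding_le p (i, true) n_gt0; rewrite /= -/b.
set g := #|` _|.
have b_gt0 : 0 < b%:R :> R by rewrite ltr0n (leq_ltn_trans _ ball_ge).
have N_gt0 : 0 < n%:R :> R by rewrite ltr0n.
have dE : (n * 2).-1%:R = 2 * n%:R - 1 :> R.
  by rewrite -subn1 natrB ?muln_gt0 ?n_gt0 // natrM mulrC.
have d_gt0 : 0 < 2 * n%:R - 1 :> R by rewrite -dE ltr0n; lia.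
rewrite -(ler_nat R) -[(n * 2 * _).+1]addn1 !natrD !natrM !natrD !natrM dE.
set N : R := n%:R in N_gt0 d_gt0 *; set B : R := b%:R in b_gt0 *.
move=> gb.
(* Dividing [gb] by 2 N (2 N - 1) B gives the bound with 2 / B in place of
   2 / (p + 1). *)
apply: (@le_trans _ _ (1 - N^-1 + (2 * N * (2 * N - 1))^-1 + 2 / B));
  last first.
  by rewrite lerD2l ler_pM2l // lef_pV2 ?posrE ?ltr0Sn // /B ler_nat.
rewrite ler_pdivrMr // -(ler_pM2l (_ : 0 < 2 * N * (2 * N - 1))); last first.
  by rewrite !mulr_gt0.
rewrite (_ : _ * (_ * B) = (2 * N * (2 * N - 1) + 1) * B
    + 2 * (2 * N * (2 * N - 1)) - 2 * (2 * N - 1) * B); first by lra.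
by field; rewrite !gt_eqF.
Qed.

End WagnerDensity.

Local Open Scope classical_set_scope.
Local Open Scope ring_scope.

Theorem theorem11 (R : realType) (n : nat) (hn : (2 <= n)%N)
    (hD : density_exists R (@endo_tuple n @` @wagner_endo n)) :
  density R (@endo_tuple n @` @wagner_endo n)
    <= (1 - n%:R^-1 + (2 * n%:R * (2 * n%:R - 1))^-1) ^+ n.
Proof.
set c := 1 - _ + _.
have lim_c : c + 2 * @harmonic R p @[p --> \oo] --> c.
  rewrite -[X in _ --> X]addr0 -(mulr0 2).
  by apply: cvgD; [exact: cvg_cst | apply: cvgMl_tmp; exact: cvg_harmonic].
have lim_cn : (c + 2 * @harmonic R p) ^+ n @[p --> \oo] --> c ^+ n.
  exact: (cvg_comp _ _ lim_c (@exprn_continuous R n c)).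
rewrite -(cvg_lim _ lim_cn) //; apply: ler_lim => //.
  by apply/cvg_ex; exists (c ^+ n).
by apply: nearW => p; apply: density_seq_wagner_le; apply: ltnW.
Qed.
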